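(* Let $n\ge 2$ and $1\le t\le n-1$, and put $T=3^t$ and $M=3^{n-t}$. Let $C$ be the ternary code of length $3^n$ with parity check matrix $H_{n,t}$, and let $\mathcal{D}$ be the triple system on $V=\{1,\dots,3^n\}$ whose blocks are the supports of the codewords of weight $3$ in $C$ with all nonzero entries equal to $1$. Then the number $s'(n,t)$ of distinct Steiner triple systems on $V$ all of whose blocks are blocks of $\mathcal{D}$ (these have $3$-rank at most $3^n-n-1+t$) is $$s'(n,t)=N_1(T)^M\cdot N_3(T)^{M(M-1)/6}.$$
   Context: $B_n$ denotes an $n\times 3^n$ ternary matrix whose columns are all the distinct vectors of $\mathrm{GF}(3)^n$. $B_{n,t}$ is the $(n-t)\times 3^n$ matrix obtained from $B_n$ by deleting $t$ rows; its columns consist of every vector of $\mathrm{GF}(3)^{n-t}$ exactly $3^t$ times. $H_{n,t}$ is the $(n-t+1)\times 3^n$ matrix whose first row is the all-one vector and whose remaining rows are those of $B_{n,t}$. $C=\{c\in\mathrm{GF}(3)^{3^n}: H_{n,t}c^{T}=0\}$. A Steiner triple system (STS) on a set $V$ is a collection of $3$-subsets (blocks) such that every $2$-subset of $V$ lies in exactly one block; ''distinct'' means distinct as sets of blocks on the fixed labeled point set. $N_1(v)$ is the number of distinct Steiner triple systems on a fixed $v$-set. $N_3(g)$ is the number of distinct transversal designs $TD[3;g]$ on three fixed pairwise disjoint groups of size $g$, i.e. sets of $3$-subsets each meeting every group in exactly one point such that any two points from different groups lie in exactly one of these $3$-subsets. The $3$-rank of an STS is the rank over $\mathrm{GF}(3)$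 of its block-by-point incidence matrix. *)

(* Defs.v *)
From mathcomp Require Import all_boot all_order all_algebra.
Set Implicit Arguments.
Unset Strict Implicit.
Unset Printing Implicit Defensive.
Import GRing.Theory.

Definition is_sts (V : finType) (S : {set {set V}}) : bool :=
  [forall b in S, #|b| == 3] &&
  [forall p : {set V}, (#|p| == 2) ==> (#|[set b in S | p \subset b]| == 1)].

Definition N1 (v : nat) : nat := #|[set S : {set {set 'I_v}} | is_sts S]|.

Definition is_td3 (V : finType) (G : 'I_3 -> {set V}) (S : {set {set V}}) :
    bool :=
  [forall b in S, (#|b| == 3) && [forall i, #|b :&: G i| == 1]] &&
  [forall i, forall j, forall x in G i, forall y in G j,
     (i != j) ==> (#|[set b in S | (x \in b) && (y \in b)]| == 1)].

Definition td_group (g : nat) (i : 'I_3) : {set 'I_3 * 'I_g} :=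
  [set p | p.1 == i].

Definition N3 (g : nat) : nat :=
  #|[set S : {set {set 'I_3 * 'I_g}} | is_td3 (@td_group g) S]|.

Definition all_columns (n : nat) (B : 'M['F_3]_(n, 3 ^ n)) : Prop :=
  bijective (fun j => col j B).

(* [keep] lists in increasing order the rows that are not deleted, so that
   [rowsub keep B] is [B] with the other [n - k] rows deleted. *)
Definition row_selection (k n : nat) (keep : 'I_k -> 'I_n) : Prop :=
  forall i j : 'I_k, i < j -> keep i < keep j.

Definition parity_check (k n N : nat) (keep : 'I_k -> 'I_n)
    (B : 'M['F_3]_(n, N)) : 'M['F_3]_(1 + k, N) :=
  col_mx (const_mx 1%R) (rowsub keep B).

Definition code (m N : nat) (H : 'M['F_3]_(m, N)) : {set 'rV['F_3]_N} :=
  [set c | (H *m c^T == 0)%R].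

Definition supp (N : nat) (c : 'rV['F_3]_N) : {set 'I_N} :=
  [set j | (c ord0 j != 0)%R].

Definition triple_system (N : nat) (C : {set 'rV['F_3]_N}) :
    {set {set 'I_N}} :=
  [set supp c | c in C & (#|supp c| == 3) &&
                         [forall j in supp c, (c ord0 j == 1)%R]].

Definition sts_within (V : finType) (D : {set {set V}}) :
    {set {set {set V}}} :=
  [set S | is_sts S & S \subset D].

Definition incidence (N : nat) (S : {set {set 'I_N}}) : 'M['F_3]_(#|S|, N) :=
  (\matrix_(i < #|S|, j < N) (j \in enum_val i)%:R)%R.

Definition rank3 (N : nat) (S : {set {set 'I_N}}) : nat :=
  \rank (incidence S).

(* Main.v *)
(* Label the point [j] by [f j], the [j]-th column of [B] with the deleted rows
   removed. A triple is a block of [D] iff its three labels sum to zero over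
   GF(3), that is, iff they coincide or form a line of the affine space
   GF(3)^(n-t). The labels of two points of such a triple determine the set of
   all its labels, so a Steiner triple system inside [D] decomposes into
   independent pieces: a Steiner triple system on each of the [M] fibers of [f],
   and a transversal design on the three fibers over each of the [M(M-1)/6]
   lines. For the rank, the independent rows of the parity check matrix are
   orthogonal to all blocks of [D]. *)
Require Import Defs.
From mathcomp Require Import all_boot all_order all_algebra.
Set Implicit Arguments.
Unset Strict Implicit.
Unset Printing Implicit Defensive.
Import GRing.Theory.

(** * Designs given by block and covering conditions: splitting and transport *)

(* Both Steiner triple systems ([cov] relates distinct points) and transversal
   designs ([cov] relates points of different groups) are of this form. *)
Definition designs (V : finType) (blk : pred {set V}) (cov : rel V) :
    {set {set {set V}}} :=
  [set S : {set {set V}} | [forall b in S, blk b] &&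
    [forall x, forall y, cov x y ==>
       (#|[set b in S | (x \in b) && (y \in b)]| == 1)]].

Lemma designsP (V : finType) (blk : pred {set V}) (cov : rel V)
    (S : {set {set V}}) :
  reflect ((forall b, b \in S -> blk b) /\
           (forall x y, cov x y ->
              #|[set b in S | (x \in b) && (y \in b)]| = 1))
          (S \in designs blk cov).
Proof.
rewrite inE; apply: (iffP andP) => -[h1 h2]; split.
- by move=> b bS; move/forall_inP: h1; apply.
- move=> x y cxy; apply/eqP.
  by move/forallP: h2 => /(_ x)/forallP/(_ y)/implyP; apply.
- exact/forall_inP.
- by apply/forallP=> x; apply/forallP=> y; apply/implyP=> /h2 ->.
Qed.

Lemma eq_designs (V : finType) (blk blk' : pred {set V}) (cov cov' : rel V) :
  blk =1 blk' -> cov =2 cov' -> designs blk cov = designs blk' cov'.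
Proof.
move=> eb ec; apply/setP=> S; apply/designsP/designsP=> -[h1 h2]; split.
- by move=> b /h1; rewrite eb.
- by move=> x y; rewrite -ec; apply: h2.
- by move=> b /h1; rewrite eb.
- by move=> x y; rewrite ec; apply: h2.
Qed.

(** Every block through a covered pair has the type [sigma x y] of that pair, so the conditions for
    different types never interact. Cutting a design into its type classes is therefore a bijection
    onto the families with one design per type. *)
Lemma card_designs_split (V I : finType) (blk : pred {set V}) (cov : rel V)
    (tau : {set V} -> I) (sigma : V -> V -> I) :
  (forall b x y, blk b -> cov x y -> x \in b -> y \in b ->
     tau b = sigma x y) ->
  #|designs blk cov| =
  \prod_i #|designs (fun b => blk b && (tau b == i))
                    (fun x y => cov x y && (sigma x y == i))|.
Proof.
move=> tauE.
pose D i := designs (fun b => blk b && (tau b == i))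
                    (fun x y => cov x y && (sigma x y == i)).
pose h (S : {set {set V}}) := [ffun i => [set b in S | tau b == i]].
have h_inj : injective h.
  move=> S S' /ffunP eqh; apply/setP=> b.
  by have /setP/(_ b) := eqh (tau b); rewrite !ffunE !inE eqxx !andbT.
have -> : \prod_i #|D i| =
    #|(family (fun i => mem (D i)) : pred {ffun I -> {set {set V}}})|.
  by rewrite card_family foldrE big_map big_enum.
rewrite -(card_imset _ h_inj); apply: eq_card => F.
apply/imsetP/familyP => [[S /designsP [h1 h2] -> i] | FD].
  apply/designsP; split=> [b | x y /andP [cxy /eqP si]].
    by rewrite ffunE inE => /andP [/h1 -> ->].
  rewrite -(h2 x y cxy); apply: eq_card => b; rewrite ffunE !inE.
  case bS: (b \in S) => //=; case xb: (x \in b); rewrite ?andbF //=.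
  case yb: (y \in b); rewrite ?andbF //= andbT.
  by rewrite (tauE b x y) ?h1 // si eqxx.
have Ftau i b : b \in F i -> blk b /\ tau b = i.
  by move=> bF; have /designsP [/(_ b bF) /andP [? /eqP]] := FD i.
(* This is the union of the [F i], since by [Ftau] a block of [F i] has type [i]. *)
exists [set b | b \in F (tau b)]; last first.
  apply/ffunP=> i; rewrite ffunE; apply/setP=> b; rewrite !inE.
  case: eqP => [->|ne]; rewrite ?andbT ?andbF //.
  by apply/negP=> /Ftau [].
apply/designsP; split=> [b | x y cxy]; first by rewrite inE => /Ftau [].
have /designsP [_ /(_ x y)] := FD (sigma x y); rewrite cxy eqxx => /(_ isT) <-.
apply: eq_card => b; rewrite !inE.
case xb: (x \in b); rewrite ?andbF //=.
case yb: (y \in b); rewrite ?andbF //= !andbT.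
by apply/idP/idP=> bF; have [bb tb] := Ftau _ _ bF; move: bF;
  rewrite (tauE b x y).
Qed.

(** All blocks and covered pairs of [V] live in the image of the embedding [g], so taking images of
    blocks matches the designs. This carries the pieces over points and lines to the standard point
    sets of [N1] and [N3]. *)
Lemma card_designs_transport (U V : finType) (g : U -> V)
    (blkU : pred {set U}) (covU : rel U) (blkV : pred {set V}) (covV : rel V) :
  injective g ->
  (forall b, blkU b = blkV (g @: b)) ->
  (forall x y, covU x y = covV (g x) (g y)) ->
  (forall b, blkV b -> b \subset codom g) ->
  (forall x y, covV x y -> (x \in codom g) && (y \in codom g)) ->
  #|designs blkU covU| = #|designs blkV covV|.
Proof.
move=> g_inj blkE covE blk_sub cov_sub.
have gs_inj : injective (fun b : {set U} => g @: b) by apply: imset_inj.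
pose h (A : {set {set U}}) := [set g @: b | b : {set U} in A].
have h_inj : injective h by apply: imset_inj.
have cardh A x y : #|[set b in h A | (g x \in b) && (g y \in b)]| =
                   #|[set b in A | (x \in b) && (y \in b)]|.
  rewrite -(card_imset _ gs_inj); apply: eq_card => b; rewrite !inE.
  apply/andP/imsetP => [[/imsetP [b' b'A ->]]|[b']].
    by rewrite !mem_imset // => xy; exists b' => //; rewrite inE b'A.
  by rewrite inE => /andP [b'A xy] ->; rewrite !mem_imset // -?xy.
rewrite -(card_imset _ h_inj); apply: eq_card => S.
apply/imsetP/designsP => [[A /designsP [h1 h2] ->]|[h1 h2]].
  split=> [_ /imsetP [b bA ->]|x y cxy]; first by rewrite -blkE h1.
  have /andP [/codomP [x' ex] /codomP [y' ey]] := cov_sub _ _ cxy.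
  by move: cxy; rewrite ex ey -covE cardh => /h2.
have hS : S = h [set b : {set U} | g @: b \in S].
  apply/setP=> b; apply/idP/imsetP => [bS|[b']]; last by rewrite inE => ? ->.
  have eb : b = g @: (g @^-1: b).
    apply/setP=> y; apply/idP/imsetP => [yb|[x]]; last by rewrite inE => ? ->.
    have /codomP [x ex] := subsetP (blk_sub _ (h1 _ bS)) _ yb.
    by exists x; rewrite ?inE -?ex.
  by exists (g @^-1: b); rewrite ?inE -?eb.
exists [set b : {set U} | g @: b \in S] => //; apply/designsP; split=> [b|x y].
  by rewrite inE blkE => /h1.
by rewrite covE -cardh -hS => /h2.
Qed.

(** Gives the factor 1 for label sets that are neither a point nor a line. *)
Lemma designs_empty (V : finType) (blk : pred {set V}) (cov : rel V) :
  (forall b, ~~ blk b) -> (forall x y, ~~ cov x y) ->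
  #|designs blk cov| = 1.
Proof.
move=> nb nc; apply/eqP/cards1P; exists set0; apply/setP=> S; rewrite !inE.
apply/andP/eqP=> [[/forall_inP h _]|->].
  by apply/setP=> b; rewrite inE; apply/negP=> /h; apply/negP.
split; first by apply/forall_inP=> b; rewrite inE.
by apply/forallP=> x; apply/forallP=> y; rewrite (negPf (nc x y)).
Qed.

(** * Steiner triple systems and transversal designs as instances of [designs] *)

Lemma is_stsE (V : finType) (S : {set {set V}}) :
  is_sts S = (S \in designs (fun b => #|b| == 3) (fun x y => x != y)).
Proof.
apply/andP/designsP => -[h1 h2]; split.
- by move=> b bS; move/forall_inP: h1; apply.
- move=> x y nxy; move/forallP: h2 => /(_ [set x; y])/implyP.
  rewrite cards2 nxy => /(_ isT)/eqP <-; apply: eq_card => b.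
  by rewrite !inE subUset !sub1set.
- exact/forall_inP.
- apply/forallP=> p; apply/implyP=> /cards2P [x [y [nxy ->]]].
  apply/eqP; rewrite -(h2 x y nxy); apply: eq_card => b.
  by rewrite !inE subUset !sub1set.
Qed.

Lemma N1E (v : nat) :
  N1 v = #|designs (fun b : {set 'I_v} => #|b| == 3) (fun x y => x != y)|.
Proof. by apply: eq_card => S; rewrite inE is_stsE. Qed.

Lemma N3E (g : nat) :
  N3 g = #|designs (fun b : {set 'I_3 * 'I_g} =>
                      (#|b| == 3) && [forall i, #|b :&: td_group g i| == 1])
                   (fun x y => x.1 != y.1)|.
Proof.
apply: eq_card => S; rewrite inE; apply/andP/designsP => -[h1 h2]; split.
- by move=> b bS; move/forall_inP: h1; apply.
- move=> x y nxy; move/forallP: h2 => /(_ x.1)/forallP/(_ y.1).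
  move=> /forall_inP/(_ x); rewrite inE eqxx => /(_ isT).
  move=> /forall_inP/(_ y); rewrite inE eqxx => /(_ isT).
  by rewrite nxy => /eqP.
- exact/forall_inP.
- apply/forallP=> i; apply/forallP=> j; apply/forall_inP=> x.
  rewrite inE => /eqP <-; apply/forall_inP=> y; rewrite inE => /eqP <-.
  by apply/implyP=> /h2 ->.
Qed.

(** * Affine lines in characteristic 3 *)

Section Lines.
Local Open Scope ring_scope.
Variables (W : finZmodType) (W3 : forall w : W, w *+ 3 = 0).

(* The affine line through [x] and [y] in characteristic 3; just [{x}] when
   [x = y]. *)
Definition join (x y : W) : {set W} := [set x; y; - (x + y)].

(** Over GF(3), three distinct points are collinear exactly when they sum to zero. *)
Definition is_line (l : {set W}) : bool :=
  (#|l| == 3)%N && (\sum_(w in l) w == 0).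

Lemma set3_sum (V : finType) (f : V -> W) (x y z : V) :
  x != y -> x != z -> y != z ->
  \sum_(v in [set x; y; z]) f v = f x + f y + f z.
Proof.
move=> xy xz yz; rewrite (big_setD1 z) ?inE ?eqxx ?orbT //= addrC.
have -> : [set x; y; z] :\ z = [set x; y].
  apply/setP=> v; rewrite !inE; case: (eqVneq v z) => [->|_] /=.
    by rewrite eq_sym (negPf xz) eq_sym (negPf yz).
  by rewrite orbF.
by rewrite big_setU1 ?inE //= big_set1.
Qed.

Lemma joinxx x : join x x = [set x].
Proof.
have e : - (x + x) = x.
  by apply/eqP; rewrite eq_sym -subr_eq0 opprK -mulr2n addrC -mulrSr W3.
by apply/setP=> v; rewrite !inE e !orbb.
Qed.

(** If [x = z], then [x + y + x = 0 = x + x + x] forces [x = y]; the case [y = z] is symmetric. *)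
Lemma third_neq (x y z : W) : x + y + z = 0 -> x != y -> x != z /\ y != z.
Proof.
move=> s0 xy; split; apply: contraNneq xy => e; apply/eqP.
  apply: (addrI (x + x)); rewrite [RHS]addrAC {5}e s0 -(W3 x).
  by rewrite !mulrSr mulr0n add0r.
apply: (addIr (y + y)); rewrite addrA {2}e s0 -(W3 y).
by rewrite !mulrSr mulr0n add0r addrA.
Qed.

Lemma is_line_join x y : x != y -> is_line (join x y).
Proof.
move=> xy; have [xz yz] := third_neq (addrN (x + y)) xy.
rewrite /is_line set3_sum // addrN eqxx andbT /join setUC cardsU1 cards2 xy.
by rewrite !inE negb_or ![- _ == _]eq_sym xz yz.
Qed.

(** The third point of [b] must carry the label [- (f x + f y)], so any two points determine the
    label set, even when their labels agree. This is the compatibility that [card_designs_split]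
    asks for. *)
Lemma imset_join (V : finType) (f : V -> W) (b : {set V}) x y :
  #|b| = 3%N -> \sum_(v in b) f v = 0 -> x \in b -> y \in b -> x != y ->
  f @: b = join (f x) (f y).
Proof.
move=> b3 s0 xb yb xy.
have /eqP : (#|(b :\ x) :\ y| = 1)%N.
  move: b3; rewrite (cardsD1 x) xb (cardsD1 y (b :\ x)) !inE yb eq_sym xy.
  by case.
case/cards1P=> z ez.
have /setD1P [zy /setD1P [zx zb]] : z \in (b :\ x) :\ y by rewrite ez inE.
have eb : b = [set x; y; z].
  apply/setP=> v; rewrite !inE; have /setP/(_ v) := ez; rewrite !inE.
  case: (eqVneq v x) => [->|_]; first by rewrite xb.
  by case: (eqVneq v y) => [->|_] //=; rewrite yb.
move: s0; rewrite eb set3_sum // 1?eq_sym // => /eqP.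
by rewrite addr_eq0 !imsetU !imset_set1 /join => /eqP ->; rewrite opprK.
Qed.

Lemma line_join l x y :
  is_line l -> x \in l -> y \in l -> x != y -> join x y = l.
Proof.
case/andP=> /eqP l3 /eqP s0 xl yl xy.
by rewrite -[RHS]imset_id -(imset_join (f := id) l3 s0 xl yl xy).
Qed.

Lemma card_offdiag (V : finType) (l : {set V}) :
  #|[set p in setX l l | p.1 != p.2]| = (#|l| * (#|l| - 1))%N.
Proof.
rewrite mulnBr muln1 -cardsX; apply/eqP.
rewrite -(cardsID [set p | p.1 == p.2] (setX l l)).
have -> : setX l l :&: [set p | p.1 == p.2] = [set (x, x) | x in l].
  apply/setP=> -[x y]; rewrite !inE /=; apply/idP/imsetP.
    by case/andP=> /andP [xl _] /eqP <-; exists x.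
  by case=> z zl [-> ->]; rewrite zl eqxx.
rewrite card_imset => [|x y [] //]; rewrite addKn; apply/eqP/eq_card=> p.
by rewrite !inE andbC.
Qed.

(** Double counting of ordered pairs of distinct points: each lies on exactly one line, its join,
    and each line holds six. *)
Lemma card_lines : (6 * #|[set l | is_line l]| = #|W| * (#|W| - 1))%N.
Proof.
rewrite -cardsT -card_offdiag -[RHS]sum1_card.
rewrite (partition_big (fun p => join p.1 p.2) is_line) /=; last first.
  by move=> p; rewrite !inE => /is_line_join.
rewrite (eq_bigr (fun=> 6)) => [|l ll].
  rewrite sum_nat_const mulnC; congr (_ * _)%N.
  by apply: eq_card => l; rewrite inE.
have /andP [/eqP l3 _] := ll.
have -> : 6 = (#|l| * (#|l| - 1))%N by rewrite l3.
rewrite -card_offdiag sum1dep_card; apply: eq_card => -[x y]; rewrite !inE /=.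
case: (eqVneq x y) => [|xy] /=; rewrite ?andbF // andbT.
apply/eqP/andP => [<-|[xl yl]]; last exact: line_join.
by rewrite !inE !eqxx !orbT.
Qed.

Lemma join_set1 x y w : (join x y == [set w]) = (x == w) && (y == w).
Proof.
apply/eqP/andP => [e|[/eqP -> /eqP ->]]; last exact: joinxx.
by split; rewrite -in_set1 -e !inE eqxx ?orbT.
Qed.

Lemma join_point_or_line x y : (#|join x y| == 1)%N || is_line (join x y).
Proof.
by case: (eqVneq x y) => [->|/is_line_join ->];
  rewrite ?orbT // joinxx cards1.
Qed.

(** * Counting the systems of zero-sum triples for a labelling with fibers of equal size *)

Section Fibers.
Variables (V : finType) (f : V -> W) (T : nat).
Hypothesis fiber_card : forall w, #|[set v | f v == w]| = T.

(** With column labels for [f], these are the blocks of the triple system; see [triple_systemE]. *)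
Definition zero_sum3 (b : {set V}) : bool :=
  (#|b| == 3)%N && (\sum_(v in b) f v == 0).

Lemma fiber_enum : exists e : W -> 'I_T -> V,
  [/\ forall w, injective (e w), forall w k, f (e w k) = w &
      forall v, v \in codom (e (f v))].
Proof.
exists (fun w k => enum_val (cast_ord (esym (fiber_card w)) k)); split.
- by move=> w k k' /enum_val_inj/cast_ord_inj.
- move=> w k; apply/eqP.
  by have := enum_valP (cast_ord (esym (fiber_card w)) k); rewrite inE.
- move=> v; have vf : v \in [set v' | f v' == f v] by rewrite inE.
  apply/codomP; exists (cast_ord (fiber_card (f v)) (enum_rank_in vf v)).
  by rewrite cast_ordK enum_rankK_in.
Qed.

(** Any three points of one fiber have label sum [w *+ 3 = 0], so every 3-subset of the fiber is
    admissible. *)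
Lemma card_designs_point (w : W) :
  #|designs (fun b => zero_sum3 b && (f @: b == [set w]))
            (fun x y => (x != y) && (join (f x) (f y) == [set w]))| = N1 T.
Proof.
have [e [e_inj fe e_codom]] := fiber_enum.
rewrite N1E; apply/esym.
apply: (card_designs_transport (e_inj w)) => [b|x y|b|x y].
- rewrite /zero_sum3 card_imset //; case: eqP => //= b3.
  rewrite big_imset /=; last by move=> x y _ _ /e_inj.
  rewrite (eq_bigr (fun=> w)) // sumr_const b3 W3 eqxx -imset_comp /=.
  apply/esym/eqP/setP=> w'; rewrite inE.
  apply/imsetP/eqP => [[x _ ->] /=|->] //.
  have /card_gt0P [x xb] : (0 < #|b|)%N by rewrite b3.
  by exists x => //=; rewrite fe.
- by rewrite !fe joinxx eqxx andbT (inj_eq (@e_inj w)).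
- case/andP=> _ /eqP fb; apply/subsetP=> v vb.
  have : f v \in f @: b by apply: imset_f.
  by rewrite fb inE => /eqP <-.
- rewrite join_set1 => /and3P [_ /eqP fx /eqP fy].
  by apply/andP; split; [rewrite -fx | rewrite -fy]; apply: e_codom.
Qed.

(** A triple whose labels fill the line [l] has one point in each of its three fibers; conversely,
    such a triple has the sum over [l], which is zero, as its label sum. The pairs with join [l] are
    those in different fibers over [l]. *)
Lemma card_designs_line (l : {set W}) : is_line l ->
  #|designs (fun b => zero_sum3 b && (f @: b == l))
            (fun x y => (x != y) && (join (f x) (f y) == l))| = N3 T.
Proof.
move=> ll; have [e [e_inj fe e_codom]] := fiber_enum.
have /andP [/eqP l3 /eqP l0] := ll.
pose w (i : 'I_3) : W := enum_val (cast_ord (esym l3) i).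
have w_inj : injective w by move=> i j /enum_val_inj/cast_ord_inj.
have wl i : w i \in l by apply: enum_valP.
have wE : w @: setT = l.
  apply/eqP; rewrite eqEcard card_imset // cardsT card_ord l3 leqnn andbT.
  by apply/subsetP=> _ /imsetP [i _ ->].
pose g (p : 'I_3 * 'I_T) : V := e (w p.1) p.2.
have fg p : f (g p) = w p.1 by rewrite fe.
have g_inj : injective g.
  move=> [i k] [j k'] eg; have := congr1 f eg; rewrite !fg /= => /w_inj ij.
  by rewrite -ij in eg *; move: eg => /e_inj /= ->.
have g_codom v : f v \in l -> v \in codom g.
  rewrite -wE => /imsetP [i _ fv]; have /codomP [k vk] := e_codom v.
  by apply/codomP; exists (i, k); rewrite /g /= -fv.
rewrite N3E; apply/esym.
apply: (card_designs_transport g_inj) => [b|p q|b|x y].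
- rewrite /zero_sum3 card_imset //; case: eqP => //= b3.
  (* Since [w] numbers [l], the labels fill [l] iff [b] reaches all three groups. *)
  have -> : (f @: (g @: b) == l) = (fst @: b == setT).
    rewrite -imset_comp -wE -(inj_eq (imset_inj w_inj)) -imset_comp.
    by congr (_ == _); apply: eq_imset => p /=.
  apply/forallP/andP => [b1|[_ /eqP bT] i].
    have bT : fst @: b = setT.
      apply/setP=> i; rewrite inE; apply/imsetP.
      have /card_gt0P [p] : (0 < #|b :&: td_group T i|)%N
        by rewrite (eqP (b1 i)).
      by rewrite !inE => /andP [pb /eqP pi]; exists p.
    split; last by rewrite bT.
    (* Three points reach three groups, so [fst] is injective on [b] and the label sum can be
       reindexed as the sum over [l]. *)
    have fst_inj : {in b &, injective fst}.
      by apply/imset_injP; rewrite bT cardsT card_ord b3.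
    rewrite big_imset /=; last by move=> p q _ _ /g_inj.
    rewrite (eq_bigr (fun p => w p.1)) // -(big_imset _ fst_inj) bT /=.
    by rewrite -(big_imset id (in2W w_inj)) wE l0.
  have fst_inj : {in b &, injective fst}.
    by apply/imset_injP; rewrite bT cardsT card_ord b3.
  have /imsetP [p pb pi] : i \in fst @: b by rewrite bT inE.
  apply/cards1P; exists p; apply/setP=> q; rewrite !inE.
  apply/andP/eqP => [[qb /eqP qi]|->]; last by rewrite pb pi.
  by apply: fst_inj; rewrite // qi.
- rewrite !fg; case: (eqVneq p.1 q.1) => [->|pq] /=.
    rewrite joinxx; apply/esym/negP=> /andP [_ /eqP e1].
    by have := l3; rewrite -e1 cards1.
  rewrite (line_join ll) ?(inj_eq w_inj) // eqxx andbT.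
  by apply/esym; apply: contraNneq pq => /g_inj ->.
- case/andP=> _ /eqP fb; apply/subsetP=> v vb.
  by apply: g_codom; rewrite -fb imset_f.
- by case/andP=> _ /eqP jl; rewrite !g_codom // -jl !inE eqxx ?orbT.
Qed.

Lemma card_sts_zero_sum3 :
  #|sts_within [set b | zero_sum3 b]| =
  (N1 T ^ #|W| * N3 T ^ (#|W| * (#|W| - 1) %/ 6))%N.
Proof.
have -> : sts_within [set b | zero_sum3 b] =
          designs zero_sum3 (fun x y : V => x != y).
  apply/setP=> S; rewrite inE is_stsE.
  apply/andP/designsP => [[/designsP [h1 h2] /subsetP SD]|[h1 h2]].
    by split=> // b /SD; rewrite inE.
  split; last by apply/subsetP=> b /h1; rewrite inE.
  by apply/designsP; split=> // b /h1 /andP [].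
have tauE (b : {set V}) x y : zero_sum3 b -> x != y -> x \in b -> y \in b ->
    f @: b = join (f x) (f y).
  by case/andP=> /eqP b3 /eqP s0 xy xb yb; apply: imset_join.
rewrite (card_designs_split (tau := fun b => f @: b) tauE).
(* The product over label sets separates into singletons, then lines, then all other sets. *)
rewrite (bigID (fun l : {set W} => #|l| == 1%N)) /=; congr (_ * _)%N.
  rewrite (eq_bigr (fun=> N1 T)) => [|l /cards1P [w ->]].
    rewrite prod_nat_const; congr (_ ^ _)%N.
    by rewrite -[RHS]bin1 -card_draws; apply: eq_card => l; rewrite inE.
  exact: card_designs_point.
rewrite (bigID is_line) /= [X in (_ * X)%N]big1 ?muln1 => [|l /andP [l1 nl]].
  rewrite (eq_bigr (fun=> N3 T)) => [|l /andP [_ /card_designs_line]] //.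
  rewrite prod_nat_const -card_lines mulKn //; congr (_ ^ _)%N.
  apply: eq_card => l; rewrite [RHS]inE.
  by apply: andb_idl => /andP [/eqP ->].
(* Label sets of blocks are joins, and a join is a point or a line, so no block and no pair has the
   type [l]. *)
apply: designs_empty => [b|x y]; apply/negP=> /andP [].
  move=> bz /eqP bl; have /andP [/eqP b3 _] := bz.
  have /card_gt1P [x [y [xb yb xy]]] : (1 < #|b|)%N by rewrite b3.
  have := join_point_or_line (f x) (f y).
  by rewrite -(tauE b x y) // bl (negPf l1) (negPf nl).
move=> _ /eqP jl; have := join_point_or_line (f x) (f y).
by rewrite jl (negPf l1) (negPf nl).
Qed.
End Fibers.
End Lines.

(** * The code and its triple system *)

Section Code.
Local Open Scope ring_scope.

Lemma mulmx_indicator (R : nzRingType) (m N : nat) (A : 'M[R]_(m, N))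
    (b : {set 'I_N}) :
  A *m (\row_j (j \in b)%:R)^T = \sum_(j in b) col j A.
Proof.
apply/matrixP=> i k; rewrite mxE summxE [RHS]big_mkcond; apply: eq_bigr => j _.
by rewrite !mxE; case: (j \in b); rewrite ?mulr1 ?mulr0.
Qed.

Lemma Fp3_mulrn3 (m p : nat) (A : 'M['F_3]_(m, p)) : A *+ 3 = 0.
Proof.
by apply/matrixP=> i j; rewrite mulmxnE mxE -mulr_natr pchar_Fp_0 ?mulr0.
Qed.

Variables (k n N : nat) (keep : 'I_k -> 'I_n) (B : 'M['F_3]_(n, N)).

(** On the indicator vector of a triple, the all-one row evaluates to [3 = 0] and the other rows to
    the sum of the labels. A word whose nonzero entries are 1 is the indicator of its support. *)
Lemma triple_systemE :
  triple_system (code (parity_check keep B)) =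
  [set b | zero_sum3 (fun j => col j (rowsub keep B)) b].
Proof.
apply/setP=> b; rewrite inE; pose c := (\row_j (j \in b)%:R : 'rV['F_3]_N).
have cE : supp c = b.
  by apply/setP=> j; rewrite inE mxE; case: (j \in b); rewrite ?oner_eq0 ?eqxx.
have codeE : #|b| = 3 ->
    (c \in code (parity_check keep B)) =
    (\sum_(j in b) col j (rowsub keep B) == 0).
  move=> b3; rewrite inE mul_col_mx col_mx_eq0 !mulmx_indicator.
  rewrite andb_idl // => _.
  rewrite (eq_bigr (fun=> const_mx 1)) => [|j _]; last by rewrite col_const.
  by rewrite sumr_const b3 Fp3_mulrn3.
rewrite /zero_sum3; apply/imsetP/andP => [[c']|[/eqP b3 s0]].
  rewrite inE => /and3P [c'C c3 /forall_inP c1] eb; rewrite eb c3; split=> //.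
  rewrite -eb -codeE; last by rewrite eb; apply/eqP.
  suff -> : c = c' by [].
  apply/rowP=> j; rewrite mxE eb inE; case: eqP => [//|/eqP c'j].
  by rewrite (eqP (c1 j _)) ?inE.
exists c => //; rewrite inE codeE // s0 cE b3 eqxx /=.
by apply/forall_inP=> j; rewrite mxE => ->.
Qed.

(** * Fibers of row deletion, and the rank of the parity check matrix *)

Hypothesis keep_inj : injective keep.

(** A section of row deletion, with 0 in the deleted rows. *)
Definition pad_rows (w : 'cV['F_3]_k) : 'cV['F_3]_n :=
  \col_i (if [pick j | keep j == i] is Some j then w j ord0 else 0).

Lemma pad_rowsK : cancel pad_rows (rowsub keep).
Proof.
move=> w; apply/colP=> j; rewrite !mxE.
case: pickP => [j' /eqP/keep_inj -> //|].
by move=> /(_ j); rewrite eqxx.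
Qed.

(** Row deletion is additive and has a section, so all its fibers are translates of the kernel;
    these [3 ^ k] fibers of equal size partition the [3 ^ n] vectors. *)
Lemma card_rowsub_fiber (w : 'cV['F_3]_k) :
  (3 ^ k * #|[set v : 'cV['F_3]_n | rowsub keep v == w]| = 3 ^ n)%N.
Proof.
pose c := #|[set v : 'cV['F_3]_n | rowsub keep v == 0]|.
have rD (u v : 'cV['F_3]_n) :
    rowsub keep (u + v) = rowsub keep u + rowsub keep v.
  by apply/matrixP=> i j; rewrite !mxE.
have fiberE w' : #|[set v : 'cV['F_3]_n | rowsub keep v == w']| = c.
  rewrite -(card_imset _ (addIr (- pad_rows w'))); apply: eq_card => v.
  rewrite inE; apply/imsetP/eqP => [[v']|r0].
    rewrite inE => /eqP vE ->; apply: (addIr w').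
    by rewrite -{2}[w']pad_rowsK -rD subrK vE add0r.
  by exists (v + pad_rows w'); rewrite ?addrK // inE rD r0 add0r pad_rowsK.
have card_col m : #|{: 'cV['F_3]_m}| = (3 ^ m)%N
  by rewrite card_mx card_Fp ?muln1.
rewrite fiberE -!card_col -[RHS]sum1_card.
rewrite (partition_big (rowsub keep) predT) //= -sum_nat_const.
by apply: eq_bigr => w' _; rewrite sum1dep_card fiberE.
Qed.

Hypothesis colB : bijective (fun j => col j B).

Lemma card_col_fiber (w : 'cV['F_3]_k) :
  (3 ^ k * #|[set j | col j (rowsub keep B) == w]| = 3 ^ n)%N.
Proof.
rewrite -(card_rowsub_fiber w) -(card_imset _ (bij_inj colB)); congr (_ * _)%N.
have colE j : col j (rowsub keep B) = rowsub keep (col j B).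
  by apply/matrixP=> i i'; rewrite !mxE.
have [g _ gK] := colB; apply: eq_card => v.
rewrite [RHS]inE; apply/imsetP/idP => [[j]|rv].
  by rewrite inE colE => ? ->.
by exists (g v); rewrite ?inE ?colE gK.
Qed.

(** A linear relation among the rows is an affine function that vanishes on all labels. As every
    vector is a label, evaluating at 0 and at the unit vectors kills its coefficients. *)
Lemma row_free_parity_check : row_free (parity_check keep B).
Proof.
rewrite -kermx_eq0; apply/eqP/row_matrixP=> r; rewrite row0.
have : row r (kermx (parity_check keep B)) *m parity_check keep B = 0.
  by rewrite -row_mul mulmx_ker row0.
move: (row r _) => u; rewrite -[u]hsubmxK mul_row_col.
set a := lsubmx u; set v := rsubmx u => u0.
(* Reads off the entry of the relation at [g w], the index of the column [w] of [B]. *)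
have eval (w : 'cV_n) : a 0 0 + (v *m rowsub keep w) 0 0 = 0.
  have [g _ gK] := colB; have /matrixP/(_ 0 (g w)) := u0.
  rewrite !mxE big_ord1 !mxE mulr1 => u1.
  rewrite -[RHS]u1; congr (_ + _); apply: eq_bigr => j _.
  by rewrite -[in LHS](gK w) !mxE.
have a0 : a 0 0 = 0.
  by have := eval (pad_rows 0); rewrite pad_rowsK mulmx0 [X in _ + X]mxE addr0.
have v0 : v = 0.
  apply/rowP=> j; have := eval (pad_rows (delta_mx j 0)).
  by rewrite pad_rowsK a0 add0r -colE !mxE.
rewrite v0; have -> : a = 0 by apply/matrixP=> i j; rewrite !ord1 a0 mxE.
by rewrite row_mx0.
Qed.

Lemma rank3_triple_system (S : {set {set 'I_N}}) :
  S \subset triple_system (code (parity_check keep B)) ->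
  (rank3 S + (1 + k) <= N)%N.
Proof.
move=> /subsetP SD; rewrite -(eqP row_free_parity_check) -mxrank_tr.
apply: mulmx0_rank_max; apply/row_matrixP=> i; rewrite row0 row_mul.
have /SD/imsetP [c] := enum_valP i.
rewrite !inE => /and3P [/eqP Hc _ /forall_inP c1] ci.
(* The nonzero entries of [c] are 1, so the incidence row of the block is the codeword itself and
   the parity checks annihilate it. *)
have -> : row i (incidence S) = c.
  apply/rowP=> j; rewrite !mxE ci inE; case: eqP => [//|/eqP cj].
  by rewrite (eqP (c1 j _)) ?inE.
by rewrite -[LHS]trmxK trmx_mul trmxK Hc trmx0.
Qed.
End Code.

(** * Assembling the count and the rank bound *)

Theorem theorem3p9 (n t : nat) (hn : 2 <= n) (ht : 1 <= t <= n - 1)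
    (B : 'M['F_3]_(n, 3 ^ n)) (hB : all_columns B)
    (keep : 'I_(n - t) -> 'I_n) (hkeep : row_selection keep) :
  let T := 3 ^ t in
  let M := 3 ^ (n - t) in
  let D := triple_system (code (parity_check keep B)) in
  #|sts_within D| = N1 T ^ M * N3 T ^ (M * (M - 1) %/ 6) /\
  (forall S : {set {set 'I_(3 ^ n)}},
     S \in sts_within D -> rank3 S <= 3 ^ n - n - 1 + t).
Proof.
move=> T M D.
have le_tn : t <= n by case/andP: ht => _ /leq_trans; apply; apply: leq_subr.
have keep_inj : injective keep.
  move=> i j eij; apply/val_inj; case: (ltngtP i j) => // /hkeep;
  by rewrite eij ltnn.
split.
  have fiber_card w : #|[set j | col j (rowsub keep B) == w]| = T.
    (* The fiber size follows from [card_col_fiber] by cancelling [3 ^ (n - t)] in [3 ^ n]. *)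
    apply/eqP; rewrite -(eqn_pmul2l (_ : 0 < 3 ^ (n - t))) ?expn_gt0 //.
    by rewrite card_col_fiber // -expnD subnK.
  rewrite /D triple_systemE (card_sts_zero_sum3 _ fiber_card).
    by rewrite card_mx card_Fp // muln1.
  by move=> w; apply: Fp3_mulrn3.
move=> S; rewrite inE => /andP [_ /(rank3_triple_system keep_inj hB) rankS].
(* Subtraction is truncated: [n < 3 ^ n] ensures that [3 ^ n - n - 1] loses nothing, so the right
   side becomes [3 ^ n]. *)
rewrite -(leq_add2r (1 + (n - t))); apply: leq_trans rankS _.
by rewrite -addnA (addnCA t) subnKC // -subnDA addn1 add1n subnK // ltn_expl.
Qed.
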